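(* If $M$ is a separative commutative monoid, then the stable rank $\mathrm{sr}_M(a)$ of any element $a \in M$ is $1$, $2$, or $\infty$.
   Context: All monoids are commutative and written additively. For a monoid $M$ and $a \in M$, the stable rank $\mathrm{sr}_M(a) \in \mathbb{Z}_{>0} \cup \{\infty\}$ is the least positive integer $n$ such that: for all $x,y \in M$ with $na + x = a + y$ there exists $e \in M$ with $na = a + e$ and $e + x = y$. If no such $n$ exists, $\mathrm{sr}_M(a) = \infty$. $M$ is separative if $2x = x + y = 2y$ implies $x = y$ for any $x,y \in M$. *)

(* Defs.v *)
From mathcomp Require Import all_boot all_algebra.
From mathcomp Require Import boolp.
Set Implicit Arguments.
Unset Strict Implicit.
Unset Printing Implicit Defensive.
Import GRing.Theory.
Local Open Scope ring_scope.

(* Commutative additive monoids are [nmodType]s. The choice structure this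
   carries is no restriction: [gen_eqMixin] and [gen_choiceMixin] of [boolp]
   provide it on every type. *)

Definition separative (M : nmodType) : Prop :=
  forall x y : M, x *+ 2 = x + y -> x + y = y *+ 2 -> x = y.

Definition stable_rank_condition (M : nmodType) (a : M) (n : nat) : Prop :=
  forall x y : M, a *+ n + x = a + y ->
    exists e : M, a *+ n = a + e /\ e + x = y.

(* Values in the positive integers together with infinity; [None] stands for
   infinity. *)
Definition stable_rank (M : nmodType) (a : M) : option nat :=
  match pselect (exists n, (0 < n)%N && `[< stable_rank_condition a n >]) with
  | left ex_n => Some (ex_minn ex_n)
  | right _ => None
  end.

(* Main.v *)
Require Import Defs.
From mathcomp Require Import all_boot all_algebra.
From mathcomp Require Import boolp.

(* Suppose the stable rank condition holds for some [n], and that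
   [2a + x = a + y]. Absorbing [y] into [a] repeatedly gives
   [a + ny = na + (a + nx)], so the condition yields [e + a + nx = ny]; hence
   [a] lies below a multiple of [y]. As [a] also lies below [a + x],
   separativity cancels [a] from [a + (a + x) = a + y], so [y = a + x] and [a]
   itself witnesses the condition for [2]. *)

Import GRing.Theory.
Local Open Scope ring_scope.

(** Descent on [k]: separativity applied to [c *+ k + b] and [c *+ k.+1] lowers [k] by one. *)
Lemma separative_eq (M : nmodType) (hM : separative M) (b c : M) (k : nat) :
  b *+ 2 = b + c -> c *+ k + b = c *+ k.+1 -> b = c.
Proof.
move=> hb; elim: k => [|k IHk]; first by rewrite mulr0n add0r.
move=> hk; apply: IHk; apply: hM.
  by rewrite mulr2n addrACA -[b + b]mulr2n hb addrACA -mulrSr.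
by rewrite addrAC -mulrnDr addnS -addSn mulrnDr addrAC hk -mulrnDr addSn -addnS
           mulrnDr mulr2n.
Qed.

(** Next to any element with [a] as a summand, [b] may be traded for [c]; both [b] and [c *+ n] are
    such elements. *)
Lemma separative_cancel (M : nmodType) (hM : separative M) (a b c u w : M)
    (n : nat) :
  a + b = a + c -> b = a + u -> c *+ n = a + w -> b = c.
Proof.
move=> habc hb hc; apply: (@separative_eq _ hM _ _ n).
  by rewrite mulr2n {1 3}hb addrAC habc addrAC.
by rewrite mulrSr hc addrAC habc addrAC.
Qed.

(** The same [a] serves to trade the copies of [b] one at a time. *)
Lemma addr_mulrn_absorb (M : nmodType) (a b c : M) (n : nat) :
  a + b = a + c -> a + b *+ n = a + c *+ n.
Proof.
move=> habc; elim: n => [|n IHn]; first by rewrite !mulr0n.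
by rewrite !mulrS addrA habc addrAC IHn addrAC addrA.
Qed.

Lemma stable_rank_condition2 (M : nmodType) (hM : separative M) (a : M)
    (n : nat) :
  stable_rank_condition a n -> stable_rank_condition a 2.
Proof.
move=> hn x y hxy; exists a; split; first by rewrite mulr2n.
have haxy : a + (a + x) = a + y by rewrite addrA -mulr2n.
have [|e [_ he]] := hn (a + x *+ n) (y *+ n).
  by rewrite -(addr_mulrn_absorb _ _ _ _ n haxy) mulrnDl addrCA.
apply: (@separative_cancel _ hM a _ _ x (e + x *+ n) n) => //.
by rewrite -he addrCA.
Qed.

Local Close Scope ring_scope.

Theorem theoremD (M : nmodType) (hM : separative M) (a : M) :
  stable_rank a = Some 1 \/ stable_rank a = Some 2 \/ stable_rank a = None.
Proof.
rewrite /stable_rank; case: pselect => [ex_n|_]; last by right; right.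
case: ex_minnP => m /andP[m_gt0 /asboolP hm] /(_ 2) min_m.
(* The condition passes from the least [m] to 2, so minimality bounds [m]. *)
have : (m <= 2)%N.
  by apply/min_m/asboolP/(@stable_rank_condition2 _ hM _ m).
by case: m m_gt0 {hm min_m} => [|[|[|m]]] // _ _; [left | right; left].
Qed.
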